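(* Let $n\ge 1$, let $L_n$ be the weight matrix of the $L$-type network of order $n$ in which a fall edge from $(k,y)$ to $(k+1,y-1)$ (with $y\neq 0$) has weight $t_{y,k+y-n}$ and every horizontal edge has weight $1$, and let $L^{-1}$ denote the weight matrix of the $L$-type network of order $n$ in which a fall edge from $(k,y)$ to $(k+1,y-1)$ (with $y\ne 0$) has weight $-t_{y,n-k-1}$ and every horizontal edge has weight $1$. Then $L_nL^{-1}=I_{n+1}$, the $(n+1)\times(n+1)$ identity matrix.
   Context: Let $t_{a,b}$ be real scalars for integers $a>b\ge 0$ (the same family for both matrices). Rows and columns of $(n+1)\times(n+1)$ matrices are indexed by $0,\dots,n$. Paths of the $L$-type network of order $n$ from source $i$ to sink $j$: $\mathcal{P}^{L_n}_{i,j}$ is the set of sequences of points $(k,y_k)$, $k=0,\dots,n$, with $y_k\in\{0,\dots,n\}$, $y_0=i$, $y_n=j$, $y_{k+1}\in\{y_k,y_k-1\}$ for $k<n$, and such that $y_{k+1}=y_k-1$ implies $y_k\ge n-k$. The weight $\omega(p)$ of a path is the product of the weights of its edges (steps), and the weight matrix is the $(n+1)\times(n+1)$ matrix whose $(i,j)$ entry is $\sum_{p\in\mathcal{P}^{L_n}_{i,j}}\omega(p)$. The symbol $L^{-1}$ is a priori only the name of the second weight matrix. *)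

(* Defs.v *)
From mathcomp Require Import all_boot all_order all_algebra.
From mathcomp Require Import reals.
Set Implicit Arguments.
Unset Strict Implicit.
Unset Printing Implicit Defensive.

Import Order.TTheory GRing.Theory Num.Theory.
Local Open Scope ring_scope.

(* A step of the L-type network of order n from (k, y) to (k+1, y').          *)
(* A fall is written y'.+1 = y rather than y' = y.-1, so that no fall can     *)
(* start at height 0.                                                         *)
Definition L_step (n k y y' : nat) : bool :=
  (y' == y) || ((y'.+1 == y) && (n - k <= y)%N).

(* Paths are given by their heights: p k is y_k, for k = 0, ..., n.  For a    *)
(* step index k : 'I_n, the two ends k and k+1 of the step are the elements   *)
(* widen_ord (leqnSn n) k and lift ord0 k of 'I_n.+1.                         *)
Definition step_src n (p : {ffun 'I_n.+1 -> 'I_n.+1}) (k : 'I_n) : 'I_n.+1 :=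
  p (widen_ord (leqnSn n) k).

Definition step_tgt n (p : {ffun 'I_n.+1 -> 'I_n.+1}) (k : 'I_n) : 'I_n.+1 :=
  p (lift ord0 k).

Definition L_paths n (i j : 'I_n.+1) : {set {ffun 'I_n.+1 -> 'I_n.+1}} :=
  [set p : {ffun 'I_n.+1 -> 'I_n.+1} |
    [&& p ord0 == i, p ord_max == j &
        [forall k : 'I_n, L_step n k (step_src p k) (step_tgt p k)]]].

(* w k y y' is the weight of the edge from (k, y) to (k+1, y').               *)
Definition path_weight (R : realType) n (w : nat -> nat -> nat -> R)
    (p : {ffun 'I_n.+1 -> 'I_n.+1}) : R :=
  \prod_(k < n) w k (step_src p k) (step_tgt p k).

Definition L_weight_matrix (R : realType) n (w : nat -> nat -> nat -> R) :
    'M[R]_n.+1 :=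
  \matrix_(i, j) \sum_(p in L_paths i j) path_weight w p.

(* On the falls of the network (k < n, n - k <= y) neither truncated          *)
(* subtraction below truncates, and both only use t a b with b < a.           *)
Definition L_edge (R : realType) (t : nat -> nat -> R) (n k y y' : nat) : R :=
  if y' == y then 1 else t y (k + y - n)%N.

Definition Linv_edge (R : realType) (t : nat -> nat -> R) (n k y y' : nat) : R :=
  if y' == y then 1 else - t y (n - k - 1)%N.

Definition L_mx (R : realType) (t : nat -> nat -> R) (n : nat) : 'M[R]_n.+1 :=
  L_weight_matrix n (L_edge t n).

(* Not defined as an inverse: this is the weight matrix of a second network.  *)
Definition Linv_mx (R : realType) (t : nat -> nat -> R) (n : nat) :
    'M[R]_n.+1 :=
  L_weight_matrix n (Linv_edge t n).

(* Main.v *)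
Require Import Defs.
From mathcomp Require Import all_boot all_order all_algebra.
From mathcomp Require Import reals.
From mathcomp Require Import zify.
Import GRing.Theory.
Local Open Scope ring_scope.

(** Both weight matrices are products of lower bidiagonal matrices, one for
    each step of the network ([path_sum_prod], [L_mx_prod], [Linv_mx_prod]):
    the [k]-th factor is the identity plus the fall weights on the
    subdiagonal.  Write [x_y a] for the identity with [a] added at position
    [(y, y - 1)].  The factors of the first network expand into
      [x_n t_(n,0)], [x_(n-1) t_(n-1,0) * x_n t_(n,1)], and so on,
    and since [x_y] and [x_z] commute when [y] and [z] differ by at least two,
    the product can be regrouped by the second index [b] of [t_(a,b)] as
    [C_0 * ... * C_(n-1)], where
      [C_b = x_n t_(n,b) * x_(n-1) t_(n-1,b) * ... * x_(b+1) t_(b+1,b)].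
    The inverse of [C_b] multiplies the [x_y (- t_(y,b))] in increasing order
    of [y]; no two consecutive falls occur in that order, so it is exactly the
    bidiagonal factor of step [n - 1 - b] of the second network.  Hence the
    second product is [C_(n-1)^-1 * ... * C_0^-1].

    The regrouping is done one index at a time.  Let [P_m] be the product for
    the first network in which only the falls with second index below [m] are
    kept.  Multiplying [P_(m+1)] on the right by the factor [n - 1 - m] of the
    second network gives [P_m] ([prod_L_fall_cancel]), because that factor can
    be pushed to the left through the steps, each step absorbing one of its
    entries ([L_fall_exchange]).  Since [P_n] is the first matrix and [P_0] is
    the identity, the theorem follows. *)

(** * Path sums as matrix products *)

Section PathSums.
Set Implicit Arguments.
Unset Strict Implicit.
Variables (R : nzRingType) (N : nat).

Lemma path_sum_prod n (M : nat -> 'M[R]_N.+1) (i j : 'I_N.+1) :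
  (\prod_(k < n) M k) i j =
  \sum_(p : {ffun 'I_n.+1 -> 'I_N.+1} | (p ord0 == i) && (p ord_max == j))
     \prod_(k < n) M k (p (widen_ord (leqnSn n) k)) (p (lift ord0 k)).
Proof.
elim: n M i => [|n IHn] M i.
  rewrite big_ord0 mxE; under eq_bigr do rewrite big_ord0.
  have -> : ord_max = ord0 :> 'I_1 by apply/val_inj.
  case: (eqVneq i j) => [<-|neq_ij].
    rewrite (big_pred1 [ffun=> i]) // => p /=; rewrite andbb.
    apply/eqP/eqP => [p0|->]; last by rewrite ffunE.
    by apply/ffunP=> k; rewrite ffunE ord1.
  by rewrite big1 // => p /andP[/eqP-> /eqP eq_ij]; rewrite eq_ij eqxx in neq_ij.
(* A path starting at [i] is [i] followed by a path [q] one step shorter. *)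
pose tl (p : {ffun 'I_n.+2 -> 'I_N.+1}) := [ffun k => p (lift ord0 k)].
pose cn (q : {ffun 'I_n.+1 -> 'I_N.+1}) : {ffun 'I_n.+2 -> 'I_N.+1} :=
  [ffun k => if unlift ord0 k is Some k' then q k' else i].
have cn0 q : cn q ord0 = i by rewrite ffunE unlift_none.
have cnS q k : cn q (lift ord0 k) = q k by rewrite ffunE liftK.
rewrite (reindex_onto cn tl) /=; last first.
  move=> p /andP[/eqP p0 _]; apply/ffunP=> k; rewrite ffunE.
  by case: unliftP => [k' ->|->]; rewrite ?ffunE.
rewrite (partition_big (fun q : {ffun 'I_n.+1 -> 'I_N.+1} => q ord0)
  xpredT) //=.
rewrite big_ord_recl -mulmxE mxE; apply: eq_bigr => l _.
rewrite (IHn (fun k => M k.+1)) big_distrr /=; apply: eq_big => [q|q].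
  have -> : tl (cn q) = q by apply/ffunP=> k; rewrite ffunE cnS.
  have -> : ord_max = lift ord0 ord_max :> 'I_n.+2 by apply/val_inj.
  by rewrite cn0 cnS !eqxx andbT andbC.
move=> /andP[/eqP q0 _]; rewrite big_ord_recl cnS.
have -> : widen_ord (leqnSn n.+1) ord0 = ord0 by apply/val_inj.
rewrite cn0 q0; congr (_ * _); apply: eq_bigr => k _; rewrite cnS.
have -> : widen_ord (leqnSn n.+1) (lift ord0 k) =
          lift ord0 (widen_ord (leqnSn n) k) by apply/val_inj.
by rewrite cnS.
Qed.

End PathSums.

(** * Bidiagonal matrices *)

Section Bidiagonal.
Set Implicit Arguments.
Unset Strict Implicit.
Variables (R : nzRingType) (N : nat).
Implicit Types f g : nat -> R.

Definition subdiag_mx f : 'M[R]_N.+1 := \matrix_(i, j) (f i *+ (j.+1 == i)).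

Definition bidiag_mx f : 'M[R]_N.+1 := 1 + subdiag_mx f.

Lemma bidiag_mxE f (i j : 'I_N.+1) :
  bidiag_mx f i j = (j == i)%:R + f i *+ (j.+1 == i).
Proof. by rewrite !mxE eq_sym. Qed.

Lemma eq_bidiag_mx f g :
  (forall y, (0 < y <= N)%N -> f y = g y) -> bidiag_mx f = bidiag_mx g.
Proof.
move=> eq_fg; congr (1 + _); apply/matrixP=> i j; rewrite !mxE.
case: eqP => // ji; rewrite eq_fg //; have := ltn_ord i; lia.
Qed.

Lemma bidiag_mx0 f : (forall y, (0 < y <= N)%N -> f y = 0) -> bidiag_mx f = 1.
Proof.
move=> f0; rewrite (@eq_bidiag_mx _ (fun=> 0)) // /bidiag_mx.
rewrite -[RHS]addr0; congr (_ + _).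
by apply/matrixP=> i j; rewrite !mxE mul0rn.
Qed.

(** Position [(y, y - 2)] of the product of the subdiagonal parts holds
    [f y * g (y - 1)]; when these all vanish the subdiagonals just add up. *)
Lemma bidiag_mxM f g :
  (forall y, (0 < y < N)%N -> f y.+1 * g y = 0) ->
  bidiag_mx f * bidiag_mx g = bidiag_mx (fun y => f y + g y).
Proof.
move=> fg0; have sub0 : subdiag_mx f * subdiag_mx g = 0.
  apply/matrixP=> i j; rewrite -mulmxE !mxE big1 // => l _; rewrite !mxE.
  case: (eqVneq l.+1 (i : nat)) => [li|_]; last by rewrite mulr0n mul0r.
  case: (eqVneq j.+1 (l : nat)) => [jl|_]; last by rewrite mulr0n mulr0.
  rewrite !mulr1n -li fg0 //; have := ltn_ord i; lia.
rewrite /bidiag_mx mulrDl mulrDr mulr1 mul1r mulrDr mulr1 sub0 addr0.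
rewrite -addrA; congr (_ + _); apply/matrixP=> i j.
by rewrite !mxE mulrnDl addrC.
Qed.

End Bidiagonal.

Arguments bidiag_mx {R} N f.

(** * The two networks *)

Section Networks.
Set Implicit Arguments.
Unset Strict Implicit.
Variable R : realType.

(** Giving weight [0] to the illegal steps turns the sum over the paths of the
    network into the sum over all height sequences that computes a product of
    matrices. *)
Lemma L_weight_matrix_prod n (w : nat -> nat -> nat -> R)
    (f : nat -> nat -> R) :
    (forall k y, w k y y = 1) ->
    (forall k y, (k < n)%N -> w k y.+1 y *+ (n - k <= y.+1)%N = f k y.+1) ->
  L_weight_matrix n w = \prod_(k < n) bidiag_mx n (f k).
Proof.
move=> w1 wf; apply/matrixP=> i j.
rewrite mxE (path_sum_prod _ (fun k => bidiag_mx n (f k))).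
have entry (k : 'I_n) (x y : 'I_n.+1) : bidiag_mx n (f k) x y =
    if L_step n k x y then w k x y else 0.
  rewrite bidiag_mxE /L_step -val_eqE /=.
  case: eqVneq => [->|neq_yx] /=.
    by rewrite w1 gtn_eqF // mulr0n addr0.
  case: eqVneq => [<-|_] /=; last by rewrite mulr0n addr0.
  by rewrite -wf // mulr1n add0r; case: ifP.
rewrite [RHS](bigID (fun p : {ffun 'I_n.+1 -> 'I_n.+1} =>
  [forall k : 'I_n, L_step n k (step_src p k) (step_tgt p k)])) /=.
rewrite [X in _ = _ + X]big1 ?addr0 => [|p /andP[_ /forallPn[k nstep]]].
  apply: eq_big => [p|p]; rewrite inE andbA //.
  move=> /andP[_ /forallP steps]; apply: eq_bigr => k _.
  by rewrite entry (steps k).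
by apply/eqP/prodf_eq0; exists k => //; rewrite entry (negPf nstep).
Qed.

Variables (t : nat -> nat -> R) (n : nat).

(** Falls of the first network in step [k] whose weight [t a b] has [b < m]. *)
Definition L_fall (m k y : nat) : R :=
  t y (k + y - n)%N *+ (n - k <= y < n - k + m)%N.

Definition Linv_fall (k y : nat) : R := - t y (n - k - 1)%N *+ (n - k <= y)%N.

(** The entries of the factor of the second network with [b = m] that are not
    yet absorbed when this factor stands in front of step [k]. *)
Definition Linv_rest (m k y : nat) : R := - t y m *+ (n - k + m < y)%N.

Lemma L_mx_prod : L_mx t n = \prod_(0 <= k < n) bidiag_mx n (L_fall n k).
Proof.
rewrite big_mkord /L_mx (@L_weight_matrix_prod _ _ (fun k y =>
  t y (k + y - n)%N *+ (n - k <= y)%N)) => [|k y|k y ltkn].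
- apply: eq_bigr => k _; apply: eq_bidiag_mx => y /andP[_ leyn].
  by rewrite /L_fall; congr (_ *+ _); have := ltn_ord k; lia.
- by rewrite /L_edge eqxx.
- by rewrite /L_edge ltn_eqF.
Qed.

Lemma Linv_mx_prod : Linv_mx t n = \prod_(0 <= k < n) bidiag_mx n (Linv_fall k).
Proof.
rewrite big_mkord /Linv_mx (@L_weight_matrix_prod _ _ Linv_fall) // => k y *.
  by rewrite /Linv_edge eqxx.
by rewrite /Linv_edge ltn_eqF.
Qed.

(** Put [z = n - k + m].  On the left a fall of the first factor ends below [z]
    and one of the second starts at [z] or above; on the right a fall of the
    first factor ends at [z] or above and one of the second starts below [z].
    So no two falls combine and only the sums of the subdiagonals matter.
    These agree because the entry at height [z], which is in [L_fall m.+1 k]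
    but not in [L_fall m k], is cancelled by the one that is in
    [Linv_rest m k.+1] but not in [Linv_rest m k]. *)
Lemma L_fall_exchange m k : (k < n)%N ->
  bidiag_mx n (L_fall m.+1 k) * bidiag_mx n (Linv_rest m k.+1) =
  bidiag_mx n (Linv_rest m k) * bidiag_mx n (L_fall m k).
Proof.
move=> ltkn; rewrite !bidiag_mxM => [|y _|y _].
- apply: eq_bidiag_mx => y _; rewrite /L_fall /Linv_rest.
  case: (ltngtP y (n - k + m)%N) => [lt_y|gt_y|eq_y].
  + have -> : (n - k <= y < n - k + m.+1)%N = (n - k <= y)%N by lia.
    have -> : (n - k.+1 + m < y)%N = false by lia.
    by rewrite andbT !mulr0n addr0 add0r.
  + have -> : (n - k <= y < n - k + m.+1)%N = false by lia.
    have -> : (n - k.+1 + m < y)%N by lia.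
    by rewrite andbF mulr0n add0r addr0.
  + have -> : (n - k <= y < n - k + m.+1)%N by lia.
    have -> : (n - k.+1 + m < y)%N by lia.
    have -> : (k + y - n = m)%N by lia.
    by rewrite andbF !mulr0n !mulr1n subrr addr0.
- rewrite /L_fall /Linv_rest.
  case: (boolP (n - k + m < y.+1)%N) => ?; last by rewrite mulr0n mul0r.
  have -> : (n - k <= y < n - k + m)%N = false by lia.
  by rewrite mulr0n mulr0.
- rewrite /L_fall /Linv_rest.
  case: (boolP (n - k.+1 + m < y)%N) => ?; last by rewrite mulr0n mulr0.
  have -> : (n - k <= y.+1 < n - k + m.+1)%N = false by lia.
  by rewrite mulr0n mul0r.
Qed.

Lemma prod_L_fall_rest m j : (j <= n)%N ->
  (\prod_(0 <= k < j) bidiag_mx n (L_fall m.+1 k)) *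
     bidiag_mx n (Linv_rest m j) =
  \prod_(0 <= k < j) bidiag_mx n (L_fall m k).
Proof.
elim: j => [_|j IHj ltjn].
  rewrite !big_nil mul1r bidiag_mx0 // => y /andP[_ leyn].
  by rewrite /Linv_rest subn0 ltnNge (leq_trans leyn (leq_addr _ _)).
rewrite !big_nat_recr //= -mulrA L_fall_exchange // mulrA.
by rewrite IHj // ltnW.
Qed.

Lemma prod_L_fall_cancel m : (m < n)%N ->
  (\prod_(0 <= k < n) bidiag_mx n (L_fall m.+1 k)) *
     bidiag_mx n (Linv_fall (n - m.+1)) =
  \prod_(0 <= k < n) bidiag_mx n (L_fall m k).
Proof.
move=> ltmn; rewrite -(prod_L_fall_rest m (leqnn n)); congr (_ * _).
apply: eq_bidiag_mx => y _; rewrite /Linv_fall /Linv_rest.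
have -> : (n - (n - m.+1) - 1 = m)%N by lia.
by congr (_ *+ _); lia.
Qed.

Lemma prod_L_fall_mul_Linv m : (m <= n)%N ->
  (\prod_(0 <= k < n) bidiag_mx n (L_fall m k)) *
     (\prod_(n - m <= k < n) bidiag_mx n (Linv_fall k)) = 1.
Proof.
elim: m => [_|m IHm ltmn].
  rewrite subn0 [X in _ * X]big_geq // mulr1 big1 // => k _.
  apply: bidiag_mx0 => y _; rewrite /L_fall addn0.
  by have -> : (n - k <= y < n - k)%N = false by lia.
rewrite [X in _ * X]big_ltn; last by lia.
rewrite mulrA prod_L_fall_cancel // subnSK // IHm //.
exact: ltnW.
Qed.

End Networks.

Theorem theorem4p3 (R : realType) (n : nat) (hn : (1 <= n)%N)
    (t : nat -> nat -> R) :
  L_mx t n *m Linv_mx t n = 1%:M.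
Proof.
rewrite L_mx_prod Linv_mx_prod mulmxE.
by have := prod_L_fall_mul_Linv t (leqnn n); rewrite subnn.
Qed.
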